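(* There exists an infinite graph $G$ of bounded degree and of polynomial growth such that the adjacency operator $A_G$ on $\ell^2(G)$ satisfies $$\sigma_{\mathrm{ess}}(A_G)\setminus\overline{\bigcup_{L\in\mathcal{R}(A_G)}\sigma(L)}\neq\emptyset.$$
   Context: All graphs are simple, undirected and connected; a graph $G$ is identified with its vertex set $V(G)$, $u\sim v$ means that $u,v$ are adjacent, and $\mathrm{dist}$ is the graph distance. A Schrödinger operator on a graph $G$ is an operator $H=\Delta+Q$ on $\ell^2(G)=\ell^2(V(G))$ acting by $(H\psi)(v)=\sum_{u\sim v}(\psi(u)-\psi(v))+Q(v)\psi(v)$, where $Q:V(G)\to\mathbb{R}$ is a bounded function. The adjacency operator $(A_G\psi)(v)=\sum_{u\sim v}\psi(u)$ is the Schrödinger operator with $Q(v)=\deg(v)$. $\sigma(\cdot)$ is the spectrum; $\sigma_{\mathrm{ess}}(\cdot)$ is the essential spectrum (the spectrum minus the isolated eigenvalues of finite multiplicity). Growth. Let $B_r(u)=\{v\in G:\mathrm{dist}(u,v)\le r\}$ and $N_u(r)=|B_r(u)|$. $G$ is of polynomial growth if there exist $\alpha,\beta>0$, a vertex $v_0\in G$ and constants $c,c'>0$ such that $c\,r^\alpha\le N_{v_0}(r)\le c'\,r^\beta$ for all $r\in\mathbb{N}$. $\mathcal{R}$-limits. Let $H$ be a Schrödinger operator on $G$. Put $N_{v,r}=|B_r(v)|$. For a bijection $\eta:B_r(v)\to\{1,\dots,N_{v,r}\}$ let $\mathcal{I}_\eta:\ell^2(B_r(v))\to\mathbb{C}^{N_{v,r}}$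 be the unitary map $\delta_u\mapsto e_{\eta(u)}$, and let $M^{(v)}_{\eta,r}=\mathcal{I}_\eta\, H|_{B_r(v)}\,\mathcal{I}_\eta^{-1}$, where $H|_{B_r(v)}$ is the restriction (compression) of $H$ to $\ell^2(B_r(v))$. A sequence $\{\mathcal{I}_{\eta_r}\}_{r\ge1}$ with bijections $\eta_r:B_r(v)\to\{1,\dots,N_{v,r}\}$ is a coherent sequence at $v$ if $\eta_s(u)=\eta_r(u)$ for all $r<s$ and $u\in B_r(v)$; in this case write $M^{(v)}_r=M^{(v)}_{\eta_r,r}$. A path to infinity in $G$ is a sequence of vertices $\{v_n\}_{n\ge0}$ with $v_{n+1}\sim v_n$ for all $n$ and $\mathrm{dist}(v_n,v_0)\to\infty$ monotonically as $n\to\infty$. Given a graph $G'$, a vertex $v_0'\in G'$ and a Schrödinger operator $H'$ on $G'$, the triple $\{H',G',v_0'\}$ is an $\mathcal{R}$-limit of $H$ along the path to infinity $\{v_n\}$ if there is a strictly increasing sequence of indices $\{n_j\}_{j\ge1}$ such that (i) for every $j$ there is a coherent sequence of isomorphisms at $v_{n_j}$; (ii) there is a coherent sequence of isomorphisms at $v_0'$ (for $H'$, $G'$); (iii) for every $r\in\mathbb{N}$, $N_{v_{n_j},r}=N_{v_0',r}$ for all sufficiently large $j$, and $\lim_{j\to\infty}M^{(v_{n_j})}_r=M^{(v_0')}_r$ for the matrices defined by these coherent sequences. $\mathcal{R}(H)$ denotes the set of all $\mathcal{R}$-limits of $H$ (along all paths to infinity); an element $L\in\mathcal{R}(H)$ is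 identified with the operator $H'$ on $\ell^2(G')$. *)

(* Defs.v *)
From HB Require Import structures.
From mathcomp Require Import all_boot all_order all_algebra complex finmap.
From mathcomp Require Import all_classical all_reals all_analysis.

Set Implicit Arguments.
Unset Strict Implicit.
Unset Printing Implicit Defensive.

Import Order.TTheory GRing.Theory Num.Theory numFieldNormedType.Exports.

Local Open Scope classical_set_scope.
Local Open Scope ring_scope.

(** ** Graphs *)

Record graph (V : choiceType) := Graph {
  adj :> rel V;
  adj_sym : symmetric adj;
  adj_irr : irreflexive adj;
  adj_connected : forall u v : V, exists p : seq V, path adj u p && (last u p == v)
}.

Section Graphs.
Variables (V : choiceType) (G : graph V).
Implicit Types (u v : V) (r n : nat).

Definition walk_of_length u v n : bool :=
  `[< exists p : seq V, [&& path G u p, last u p == v & size p == n] >].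

Lemma ex_walk_of_length u v : exists n, walk_of_length u v n.
Proof.
have [p /andP[pG pv]] := adj_connected G u v.
by exists (size p); apply/asboolP; exists p; rewrite pG pv eqxx.
Qed.

Definition dist u v : nat := ex_minn (ex_walk_of_length u v).

Definition gball u r : set V := [set v | (dist u v <= r)%N].

(* Junk value 0 on infinite balls; balls are finite under [bounded_degree]. *)
Definition ball_size u r : nat := #|` fset_set (gball u r)|.

Definition neighbors v : set V := [set u | G v u].

Definition degree v : nat := #|` fset_set (neighbors v)|.

Definition bounded_degree := exists d : nat, forall v, (neighbors v #<= `I_d)%card.

(* At r = 0 the upper bound would read 1 <= c' * 0, so r ranges over r >= 1. *)
Definition polynomial_growth (R : realType) :=
  exists (a b : R) (v0 : V) (c c' : R),
    [/\ 0 < a, 0 < b, 0 < c, 0 < c' &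
      forall r, (0 < r)%N ->
        c * r%:R `^ a <= (ball_size v0 r)%:R <= c' * r%:R `^ b].

Definition path_to_infinity (x : nat -> V) :=
  [/\ forall n, G (x n.+1) (x n),
      {homo (fun n => dist (x n) (x 0%N)) : m n / (m <= n)%N} &
      (fun n => dist (x n) (x 0%N)) @ \oo --> \oo].

(* [eta r] is only relevant on the ball of radius r; indices start from 0,
   i.e. 1, ..., N is replaced by 0, ..., N - 1. *)
Definition coherent v (eta : nat -> V -> nat) :=
  (forall r, (0 < r)%N -> set_bij (gball v r) `I_(ball_size v r) (eta r)) /\
  (forall r s u, (0 < r < s)%N -> gball v r u -> eta s u = eta r u).

End Graphs.

(** ** Operators on l^2(V), represented as maps on all functions V -> C *)

(* The cast to [numFieldType] is what makes the canonical topology of the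
   complex numbers available. *)
Notation cplx R := (complex R : numFieldType).

Section Operators.
Variables (R : realType) (V : choiceType).
Implicit Types (f g : V -> R[i]) (H B : (V -> R[i]) -> V -> R[i]).

Definition l2sum f : \bar R := \esum_(v in [set: V]) ((Normc.normc (f v)) ^+ 2)%:E.

Definition l2 f : Prop := (l2sum f < +oo)%E.

Definition l2norm f : R := Num.sqrt (fine (l2sum f)).

Definition bounded_operator B :=
  [/\ forall f, l2 f -> l2 (B f),
      forall (a : R[i]) f g, l2 f -> l2 g -> B ((a \*o f) \+ g) = (a \*o B f) \+ B g &
      exists c : R, forall f, l2 f -> l2norm (B f) <= c * l2norm f].

Definition resolvent_set H : set (cplx R) :=
  [set z | exists B, bounded_operator B /\
    forall f, l2 f -> B (H f \- (z \*o f)) = f /\ H (B f) \- (z \*o B f) = f].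

Definition spectrum H : set (cplx R) := ~` resolvent_set H.

Definition eigenspace H (z : R[i]) : set (V -> R[i]) :=
  [set f | l2 f /\ H f = z \*o f].

Definition eigenvalue H (z : R[i]) := exists2 f, eigenspace H z f & f <> (fun=> 0).

Definition finite_multiplicity H (z : R[i]) :=
  exists (n : nat) (e : 'I_n -> V -> R[i]), forall f, eigenspace H z f ->
    exists a : 'I_n -> R[i], f = fun v => \sum_(k < n) a k * e k v.

Definition essential_spectrum H : set (cplx R) :=
  spectrum H `\` [set z | [/\ isolated (spectrum H) z, eigenvalue H z
                            & finite_multiplicity H z]].

Definition dirac_fun (u : V) : V -> R[i] := fun v => (v == u)%:R.

End Operators.

(** ** Schrödinger operators *)

Section Schrodinger.
Variables (R : realType) (V : choiceType) (G : graph V).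

Definition schrodinger (Q : V -> R) (f : V -> R[i]) : V -> R[i] :=
  fun v => \sum_(u \in neighbors G v) (f u - f v) + (Q v)%:C%C * f v.

Definition is_schrodinger (H : (V -> R[i]) -> V -> R[i]) :=
  exists Q : V -> R, (exists M : R, forall v, `|Q v| <= M) /\ H = schrodinger Q.

Definition adjacency_op (f : V -> R[i]) : V -> R[i] :=
  fun v => \sum_(u \in neighbors G v) f u.

Lemma adjacency_op_schrodinger :
  bounded_degree G -> is_schrodinger adjacency_op.
Proof.
move=> [d dG]; exists (fun v => (degree G v)%:R); split.
  by exists d%:R => v; rewrite normr_nat ler_nat; exact: geq_card_fset_set.
apply/funext => f; apply/funext => v; rewrite /schrodinger /adjacency_op.
have fin : finite_set (neighbors G v) by apply/finite_set_leP; exists d.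
rewrite !fsbig_finite//= big_split/= sumrN big_const_seq count_predT iter_addr_0.
by rewrite rmorph_nat mulr_natl subrK.
Qed.

End Schrodinger.

(** ** R-limits *)

Section RLimits.
Variables (R : realType).

(* Entry (i, j) of the matrix of the compression of H to the ball is
   <delta_u, H delta_w> = (H delta_w) u, with u, w the vertices of indices i, j.
   [N] is meant to be the cardinality of the ball. *)
Definition ball_matrix (V : choiceType) (G : graph V)
    (H : (V -> R[i]) -> V -> R[i]) (v : V) (eta : nat -> V -> nat) (r N : nat) :
    'M[cplx R]_N :=
  let vertex := 'pinv_(fun=> v) (gball G v r) (eta r) in
  \matrix_(i < N, j < N) H (dirac_fun R (vertex j)) (vertex i).

Definition is_Rlimit_along (V : choiceType) (G : graph V)
    (H : (V -> R[i]) -> V -> R[i]) (x : nat -> V)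
    (V' : choiceType) (G' : graph V') (H' : (V' -> R[i]) -> V' -> R[i]) (v' : V') :=
  is_schrodinger G' H' /\
  exists (n : nat -> nat) (eta : nat -> nat -> V -> nat) (eta' : nat -> V' -> nat),
    [/\ {homo n : j k / (j < k)%N},
        forall j, coherent G (x (n j)) (eta j),
        coherent G' v' eta' &
        forall r, (0 < r)%N ->
          (\forall j \near \oo, ball_size G (x (n j)) r = ball_size G' v' r) /\
          (fun j => ball_matrix G H (x (n j)) (eta j) r (ball_size G' v' r)) @ \oo
            --> ball_matrix G' H' v' eta' r (ball_size G' v' r)].

Definition is_Rlimit (V : choiceType) (G : graph V)
    (H : (V -> R[i]) -> V -> R[i])
    (V' : choiceType) (G' : graph V') (H' : (V' -> R[i]) -> V' -> R[i]) (v' : V') :=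
  exists x : nat -> V, path_to_infinity G x /\ is_Rlimit_along G H x G' H' v'.

Definition Rlimit_spectra (V : choiceType) (G : graph V)
    (H : (V -> R[i]) -> V -> R[i]) : set (cplx R) :=
  [set z | exists (V' : choiceType) (G' : graph V')
             (H' : (V' -> R[i]) -> V' -> R[i]) (v' : V'),
     is_Rlimit G H G' H' v' /\ spectrum H' z].

End RLimits.

(* Main.v *)
Require Import Defs.
From mathcomp Require Import all_boot all_order all_algebra complex finmap.
From mathcomp Require Import all_classical all_reals all_analysis.
From mathcomp Require Import zify lra ring.
Import Order.TTheory GRing.Theory Num.Theory numFieldNormedType.Exports.

(** The graph is a comb: a half-line (the spine) whose [k]-th vertex carries a
    finite tooth of length [k], with two disjoint copies of K_8 joined to the tip
    of every tooth.  The function equal to +1 on one copy, -1 on the other and 0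
    elsewhere is an eigenfunction of the adjacency operator with eigenvalue 7;
    there is one for each tooth, so 7 is in the essential spectrum.

    A path to infinity has a nondecreasing distance to its origin, so it cannot
    enter a finite tooth and come back: eventually it follows the spine, and the
    cliques recede to infinity.  Hence every R-limit is the adjacency operator of
    a graph of degree at most 3, whose spectrum lies in [|z| < 6] by a Neumann
    series argument. *)

Set Implicit Arguments.
Unset Strict Implicit.
Unset Printing Implicit Defensive.

Local Open Scope classical_set_scope.
Local Open Scope ring_scope.

(** * Distance in a graph *)

Section Distance.
Context {V : choiceType} (G : graph V).
Implicit Types u v w : V.

Lemma geodesic u v :
  exists p, [/\ path G u p, last u p = v & size p = dist G u v].
Proof.
rewrite /dist; case: ex_minnP => m /asboolP[p /and3P[pG /eqP pv /eqP pm]] _.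
by exists p.
Qed.

Lemma dist_path u p : path G u p -> (dist G u (last u p) <= size p)%N.
Proof.
move=> pG; rewrite /dist; case: ex_minnP => m _; apply.
by apply/asboolP; exists p; rewrite pG !eqxx.
Qed.

Lemma distxx v : dist G v v = 0%N.
Proof. by apply/eqP; rewrite -leqn0 (@dist_path v [::]). Qed.

Lemma dist_triangle u v w : (dist G u w <= dist G u v + dist G v w)%N.
Proof.
have [p [pG <- <-]] := geodesic u v.
have [q [qG <- <-]] := geodesic (last u p) w.
by rewrite -last_cat -size_cat dist_path// cat_path pG.
Qed.

Lemma dist_adj u v : G u v -> (dist G u v <= 1)%N.
Proof. by move=> uv; apply: (@dist_path u [:: v]); rewrite /= uv. Qed.

(** Along a geodesic [h] gains at most one per edge. This turns integer coordinates on the graph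
    into lower bounds for distances. *)
Lemma lipschitz_dist (h : V -> nat) u v :
  (forall w w', G w w' -> (h w' <= h w + 1)%N) ->
  (h v <= h u + dist G u v)%N.
Proof.
move=> hlip; have [p [pG <- <-]] := geodesic u v.
elim: p u pG => [|w p IH] u /=; first by rewrite addn0.
case/andP=> /hlip uw /IH; lia.
Qed.

Lemma lipschitz_dist_sym (h : V -> nat) u v :
  (forall w w', G w w' -> (h w' <= h w + 1)%N) ->
  (h u <= h v + dist G u v)%N.
Proof.
move=> hlip; have [p [pG <- <-]] := geodesic u v.
elim: p u pG => [|w p IH] u /=; first by rewrite addn0.
case/andP; rewrite adj_sym => /hlip uw /IH; lia.
Qed.

End Distance.

(** * Complex numbers and geometric convergence *)

Section Complex.
Context {R : realType}.
Implicit Types (x y K M : R) (z w l : R[i]).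
Local Notation normc := (@Normc.normc R).

Lemma normc_ge0 z : 0 <= normc z.
Proof. by case: z => a b; rewrite /Normc.normc sqrtr_ge0. Qed.

Lemma normc_nat n : normc (n%:R : R[i]) = n%:R.
Proof.
by rewrite -(rmorph_nat (real_complex R)) /= expr0n addr0 sqrtr_sqr ger0_norm.
Qed.

Lemma normcD z w : normc (z + w) <= normc z + normc w.
Proof. exact: le_normcD. Qed.

Lemma normcB z w : normc (z - w) <= normc z + normc w.
Proof. by rewrite (le_trans (normcD _ _))// (normcN w). Qed.

Lemma normc_sum {I : Type} (s : seq I) (f : I -> R[i]) :
  normc (\sum_(i <- s) f i) <= \sum_(i <- s) normc (f i).
Proof.
elim/big_ind2: _ => [|a b a' b' ab a'b'|//]; first by rewrite Normc.normc0.
exact: le_trans (normcD _ _) (lerD ab a'b').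
Qed.

Lemma normc_le_ReIm z : normc z <= `|complex.Re z| + `|complex.Im z|.
Proof.
case: z => a b /=; rewrite -[leRHS]ger0_norm ?addr_ge0// -sqrtr_sqr.
rewrite ler_wsqrtr// -[a ^+ 2]real_normK ?num_real// -[b ^+ 2]real_normK ?num_real//.
have := normr_ge0 a; have := normr_ge0 b; nra.
Qed.

Lemma Re_le_normc z : `|complex.Re z| <= normc z.
Proof. by case: z => a b /=; rewrite -sqrtr_sqr ler_wsqrtr// lerDl sqr_ge0. Qed.

Lemma Im_le_normc z : `|complex.Im z| <= normc z.
Proof. by case: z => a b /=; rewrite -sqrtr_sqr ler_wsqrtr// lerDr sqr_ge0. Qed.

(** Archimedean argument: [n * 2^-n <= 1], so any [n] above [K / (x - y)] makes the error smaller
    than the gap [x - y]. *)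
Lemma le_of_geometric x y K : (forall n, x <= y + K * 2^-1 ^+ n) -> x <= y.
Proof.
move=> xy; rewrite leNgt; apply/negP => yx.
have e0 : 0 < x - y by rewrite subr_gt0.
have pow n : n%:R * 2^-1 ^+ n <= 1 :> R.
  elim: n => [|n IH]; first by rewrite mul0r.
  have p1 : 2^-1 ^+ n <= 1 :> R by rewrite exprn_ile1 ?invr_ge0 ?invf_le1 ?ler1n.
  by rewrite exprS -natr1; lra.
have K0 : 0 < K.
  by have := xy 0%N; rewrite expr0 mulr1; move: e0; lra.
have := archi_boundP (ltW (divr_gt0 K0 e0)); set n := Num.bound _ => nK.
have p0 : 0 < 2^-1 ^+ n :> R by rewrite exprn_gt0// invr_gt0.
have := xy n; have := pow n; rewrite ltr_pdivrMr// in nK.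
nra.
Qed.

(** The intervals of radius [2 * K * 2^-n] around [x n] are nested, because the radius shrinks by
    [K * 2^-n], which bounds the jump; the supremum of their left ends lies in all of them. *)
Lemma real_geometric_limit (x : nat -> R) K :
  (forall n, `|x n.+1 - x n| <= K * 2^-1 ^+ n) ->
  exists l : R, forall n, `|x n - l| <= 2 * K * 2^-1 ^+ n.
Proof.
move=> xK; pose a n := x n - 2 * K * 2^-1 ^+ n; pose b n := x n + 2 * K * 2^-1 ^+ n.
have K0 : 0 <= K by have := xK 0%N; rewrite expr0 mulr1; apply: le_trans.
have p0 n : 0 <= 2^-1 ^+ n :> R by rewrite exprn_ge0// invr_ge0.
have ab n : a n <= b n.
  by rewrite /a /b; have := p0 n; nra.
have aS : nondecreasing_seq a.
  apply/nondecreasing_seqP => n; rewrite /a exprS; have := xK n.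
  by rewrite ler_norml => /andP[]; lra.
have bS : nonincreasing_seq b.
  apply/nonincreasing_seqP => n; rewrite /b exprS; have := xK n.
  by rewrite ler_norml => /andP[]; lra.
have amb m n : a m <= b n.
  apply: (le_trans (aS _ _ (leq_maxl m n))); apply: (le_trans (ab _)).
  exact: bS (leq_maxr m n).
exists (sup (range a)) => n; rewrite ler_norml; apply/andP; split.
  have : sup (range a) <= b n.
    by apply: ge_sup => [|_ [m _ <-]//]; exists (a 0%N), 0%N.
  by rewrite /b; lra.
have : a n <= sup (range a).
  apply: ub_le_sup; last by exists n.
  by exists (b n) => _ [m _ <-].
by rewrite /a; lra.
Qed.

Lemma complex_geometric_limit (u : nat -> R[i]) K :
  (forall n, normc (u n.+1 - u n) <= K * 2^-1 ^+ n) ->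
  exists l, forall n, normc (u n - l) <= 4 * K * 2^-1 ^+ n.
Proof.
move=> uK.
have [a aP] := @real_geometric_limit (fun n => complex.Re (u n)) K (fun n =>
  le_trans (eq_ind_r (fun t => `|t| <= _) (Re_le_normc _) (esym (raddfB _ _ _))) (uK n)).
have [b bP] := @real_geometric_limit (fun n => complex.Im (u n)) K (fun n =>
  le_trans (eq_ind_r (fun t => `|t| <= _) (Im_le_normc _) (esym (raddfB _ _ _))) (uK n)).
exists (a +i* b)%C => n; apply: (le_trans (normc_le_ReIm _)).
have := aP n; have := bP n; case: (u n) => c d /=; lra.
Qed.

(** The notion of limit used for the Neumann series: the explicit rate reduces every passage to the
    limit to an elementary estimate. *)
Definition geometric_cvg (u : nat -> R[i]) l :=
  exists K, forall n, normc (u n - l) <= K * 2^-1 ^+ n.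

Lemma geometric_cvg_unique u l l' :
  geometric_cvg u l -> geometric_cvg u l' -> l = l'.
Proof.
move=> [K uK] [K' uK']; apply/eqP; rewrite -subr_eq0; apply/eqP.
apply: Normc.eq0_normc; apply/eqP; rewrite eq_le normc_ge0 andbT.
apply: (@le_of_geometric _ _ (K' + K)) => n; rewrite add0r mulrDl.
rewrite (_ : l - l' = (u n - l') - (u n - l)); last by ring.
exact: le_trans (normcB _ _) (lerD _ _).
Qed.

Lemma geometric_cvgD u v l m : geometric_cvg u l -> geometric_cvg v m ->
  geometric_cvg (fun n => u n + v n) (l + m).
Proof.
move=> [K uK] [K' vK]; exists (K + K') => n; rewrite mulrDl.
rewrite (_ : _ - _ = (u n - l) + (v n - m)); last by ring.
exact: le_trans (normcD _ _) (lerD _ _).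
Qed.

Lemma geometric_cvgM a u l : geometric_cvg u l ->
  geometric_cvg (fun n => a * u n) (a * l).
Proof.
move=> [K uK]; exists (normc a * K) => n; rewrite -mulrBr Normc.normcM -mulrA.
by rewrite ler_wpM2l ?normc_ge0.
Qed.

Lemma geometric_cvg_cst l : geometric_cvg (fun=> l) l.
Proof. by exists 0 => n; rewrite subrr Normc.normc0 mul0r. Qed.

Lemma geometric_cvg_sum {I : Type} (s : seq I) (u : nat -> I -> R[i]) (l : I -> R[i]) :
  (forall i, geometric_cvg (u^~ i) (l i)) ->
  geometric_cvg (fun n => \sum_(i <- s) u n i) (\sum_(i <- s) l i).
Proof.
move=> ul; elim: s => [|i s IH].
  rewrite big_nil (_ : (fun _ => _) = fun=> 0); first exact: geometric_cvg_cst.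
  by apply/funext => n; rewrite big_nil.
rewrite big_cons (_ : (fun _ => _) = fun n => u n i + \sum_(i <- s) u n i).
  exact: geometric_cvgD.
by apply/funext => n; rewrite big_cons.
Qed.

Lemma geometric_cvgS u l : geometric_cvg u l -> geometric_cvg (fun n => u n.+1) l.
Proof.
move=> [K uK]; exists (K * 2^-1) => n.
by rewrite -mulrA -exprS.
Qed.

End Complex.

(** * The resolvent of the adjacency operator far from 0 *)

Section SquareSummable.
Context {R : realType} {V : choiceType}.
Implicit Types (f g : V -> R[i]) (M : R) (X : {fset V}).
Local Notation normc := (@Normc.normc R).

(** Control of all finite partial sums, so that estimates on the squared norm stay within finite
    real sums. *)
Definition l2bound f M := forall X, \sum_(v <- X) normc (f v) ^+ 2 <= M.

Lemma l2boundP f M : l2bound f M <-> (l2sum f <= M%:E)%E.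
Proof.
split=> [fM|fM X].
  apply: ge_ereal_sup => _ [A [finA _] <-].
  rewrite fsbig_finite//= sumEFin lee_fin; exact: fM.
rewrite -lee_fin -sumEFin; apply: le_trans fM; apply: ereal_sup_ubound.
exists [set` X]; first by split => //; exact: finite_fset.
by rewrite fsbig_finite ?set_fsetK//; exact: finite_fset.
Qed.

Lemma l2sum_ge0 f : (0 <= l2sum f)%E.
Proof. by apply: esum_ge0 => v _; rewrite lee_fin sqr_ge0. Qed.

Lemma l2_l2bound f : l2 f -> l2bound f (fine (l2sum f)).
Proof. by move=> l2f; apply/l2boundP; rewrite fineK// ge0_fin_numE ?l2sum_ge0. Qed.

Lemma l2bound_l2 f M : l2bound f M -> l2 f.
Proof. by move=> /l2boundP fM; rewrite /l2 (le_lt_trans fM)// ltry. Qed.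

Lemma l2bound_ge0 f M : l2bound f M -> 0 <= M.
Proof. by move=> /(_ fset0); rewrite big_nil. Qed.

Lemma l2bound_fine f M : l2bound f M -> fine (l2sum f) <= M.
Proof.
move=> fM; rewrite -lee_fin fineK; first exact/l2boundP.
by rewrite ge0_fin_numE ?l2sum_ge0//; exact: l2bound_l2 fM.
Qed.

Lemma l2bound_sup f M v : l2bound f M -> normc (f v) <= Num.sqrt M.
Proof.
move=> fM; rewrite -[leLHS]ger0_norm ?normc_ge0// -sqrtr_sqr.
by rewrite ler_wsqrtr//; have := fM [fset v]%fset; rewrite big_seq_fset1.
Qed.

Lemma finite_support_l2 f (s : seq V) : (forall v, v \notin s -> f v = 0) -> l2 f.
Proof.
move=> f0; apply: (@l2bound_l2 _ (\sum_(v <- undup s) normc (f v) ^+ 2)) => X.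
rewrite (bigID (fun v => v \in s))/= [X in _ + X]big1 ?addr0; last first.
  by move=> v /f0 ->; rewrite Normc.normc0 expr0n.
rewrite -big_filter (_ : \sum_(v <- undup s) _ =
   \sum_(v <- undup s | v \in X) normc (f v) ^+ 2 +
   \sum_(v <- undup s | v \notin X) normc (f v) ^+ 2); last exact: bigID.
rewrite -[X in _ <= X + _]big_filter -[leLHS]addr0 lerD ?sumr_ge0//.
  rewrite le_eqVlt (perm_big [seq v <- undup s | v \in X]) ?eqxx//=.
  apply: uniq_perm; rewrite ?filter_uniq ?undup_uniq ?fset_uniq// => v.
  by rewrite !mem_filter mem_undup andbC.
by move=> *; rewrite sqr_ge0.
Qed.

End SquareSummable.

Lemma sumr_const_seq {W : nmodType} {I : Type} (s : seq I) (x : W) :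
  \sum_(i <- s) x = x *+ size s.
Proof. by rewrite big_const_seq count_predT iter_addr_0. Qed.

(** Cauchy-Schwarz against the constant 1, obtained by summing
    [2 * x i * x j <= x i ^+ 2 + x j ^+ 2] over all pairs. *)
Lemma sqr_sum_le {R : realDomainType} {I : Type} (s : seq I) (x : I -> R) :
  (\sum_(i <- s) x i) ^+ 2 <= (size s)%:R * \sum_(i <- s) x i ^+ 2.
Proof.
rewrite -(ler_pM2l (ltr0Sn R 1)).
have -> : 2 * ((size s)%:R * \sum_(i <- s) x i ^+ 2) =
    \sum_(i <- s) \sum_(j <- s) (x i ^+ 2 + x j ^+ 2).
  under [RHS]eq_bigr do rewrite big_split/= sumr_const_seq.
  by rewrite big_split/= sumrMnl sumr_const_seq -mulr_natl; ring.
rewrite expr2 mulr_suml mulr_sumr ler_sum// => i _.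
rewrite !mulr_sumr ler_sum// => j _.
have := sqr_ge0 (x i - x j); nra.
Qed.

Section BoundedDegree.
Context {R : realType} {V : choiceType} (G : graph V) (d : nat).
Hypothesis degree_le : forall v, (neighbors G v #<= `I_d)%card.
Implicit Types (f g : V -> R[i]) (M K : R) (z : R[i]).
Local Notation normc := (@Normc.normc R).
Local Notation A := (adjacency_op (R := R) G).
Local Notation N v := (fset_set (neighbors G v)).

Lemma finite_neighbors v : finite_set (neighbors G v).
Proof. by apply/finite_set_leP; exists d. Qed.

Lemma adjacencyE f v : A f v = \sum_(u <- N v) f u.
Proof. by rewrite /adjacency_op fsbig_finite//; exact: finite_neighbors. Qed.

Lemma mem_neighbors u v : (u \in N v) = G v u.
Proof.
by rewrite in_fset_set; [apply/idP/idP; rewrite inE|exact: finite_neighbors].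
Qed.

Lemma size_neighbors v : (size (N v) <= d)%N.
Proof. exact: geq_card_fset_set. Qed.

Lemma adjacency_sup f v M : (forall u, normc (f u) <= M) -> normc (A f v) <= d%:R * M.
Proof.
move=> fM; have M0 : 0 <= M := le_trans (normc_ge0 _) (fM v).
rewrite adjacencyE (le_trans (normc_sum _ _))// (@le_trans _ _ (\sum_(u <- N v) M))//.
  by rewrite ler_sum.
by rewrite sumr_const_seq -[leLHS]mulr_natl ler_wpM2r// ler_nat size_neighbors.
Qed.

(** One factor [d] comes from Cauchy-Schwarz at each vertex, the other from exchanging the sums:
    each [u] is a neighbor of at most [d] vertices. *)
Lemma adjacency_l2bound f M : l2bound f M -> l2bound (A f) (d%:R ^+ 2 * M).
Proof.
move=> fM X; pose Y := (\bigcup_(v <- X) N v)%fset.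
pose a u := normc (f u) ^+ 2.
have a0 u : 0 <= a u by exact: sqr_ge0.
have le1 v : normc (A f v) ^+ 2 <= d%:R * \sum_(u <- N v) a u.
  rewrite adjacencyE (@le_trans _ _ ((\sum_(u <- N v) normc (f u)) ^+ 2))//.
    by rewrite ler_pXn2r ?nnegrE ?normc_ge0 ?normc_sum// sumr_ge0// => *;
      exact: normc_ge0.
  rewrite (le_trans (sqr_sum_le _ _))// ler_wpM2r ?ler_nat ?size_neighbors//.
  by apply: sumr_ge0 => u _; exact: a0.
have NY v : v \in X -> \sum_(u <- N v) a u = \sum_(u <- Y | G v u) a u.
  move=> vX; rewrite -[RHS]big_filter; apply: perm_big; apply: uniq_perm.
  - exact: fset_uniq.
  - by rewrite filter_uniq// fset_uniq.
  move=> u; rewrite mem_filter mem_neighbors; case vu : (G v u) => //=.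
  by apply/esym/bigfcupP; exists v; rewrite ?vX// mem_neighbors.
rewrite (@le_trans _ _ (\sum_(v <- X) d%:R * \sum_(u <- Y | G v u) a u))//.
  rewrite big_seq_cond [leRHS]big_seq_cond ler_sum// => v /andP[vX _].
  by rewrite -NY.
rewrite -mulr_sumr expr2 -mulrA ler_wpM2l//.
rewrite (exchange_big_dep xpredT)//= (@le_trans _ _ (\sum_(u <- Y) d%:R * a u))//.
  rewrite ler_sum// => u _; rewrite -big_filter sumr_const_seq -[leLHS]mulr_natl.
  rewrite ler_wpM2r// ler_nat (leq_trans _ (size_neighbors u))//.
  apply: uniq_leq_size; first by rewrite filter_uniq// fset_uniq.
  by move=> v; rewrite mem_filter mem_neighbors adj_sym => /andP[].
by rewrite -mulr_sumr ler_wpM2l//; exact: fM.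
Qed.

Lemma adjacencyD f g a v : A (fun u => a * f u + g u) v = a * A f v + A g v.
Proof. by rewrite !adjacencyE big_split/= mulr_sumr. Qed.

Lemma geometric_cvg_adjacency (u : nat -> V -> R[i]) (l : V -> R[i]) v :
  (forall w, geometric_cvg (u^~ w) (l w)) ->
  geometric_cvg (fun n => A (u n) v) (A l v).
Proof.
move=> ul; rewrite adjacencyE (_ : (fun _ => _) = fun n => \sum_(w <- N v) u n w).
  exact: geometric_cvg_sum.
by apply/funext => n; rewrite adjacencyE.
Qed.

(** * The Neumann series for the resolvent *)

Variable z : R[i].
Hypothesis z0 : 0 < normc z.
Hypothesis zd : 2 * d%:R <= normc z.

(* Neumann iteration for [(A - z) g = f], i.e. [g = z^-1 (A g - f)]. *)
Fixpoint neumann f n : V -> R[i] :=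
  if n is m.+1 then fun v => z^-1 * (A (neumann f m) v - f v) else fun=> 0.

Let zn0 : z != 0.
Proof. by apply: contraTneq z0 => ->; rewrite Normc.normc0 ltxx. Qed.

(** In the sup norm [A] has norm at most [d], which is at most half of [normc z]. *)
Lemma contraction f M v : (forall u, normc (f u) <= M) ->
  normc (z^-1 * A f v) <= 2^-1 * M.
Proof.
move=> fM; have M0 : 0 <= M := le_trans (normc_ge0 _) (fM v).
rewrite Normc.normcM Normc.normcV mulrC ler_pdivrMr//.
by rewrite (le_trans (adjacency_sup v fM))//; have := ler_wpM2l M0 zd; lra.
Qed.

Lemma neumann_step f M n v : (forall u, normc (f u) <= M) ->
  normc (neumann f n.+1 v - neumann f n v) <= (M / normc z) * 2^-1 ^+ n.
Proof.
move=> fM; elim: n v => [|n IH] v.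
  rewrite subr0 /= expr0 mulr1 Normc.normcM Normc.normcV mulrC.
  rewrite ler_wpM2r ?invr_ge0 ?normc_ge0// adjacencyE big1// add0r.
  by rewrite (normcN (f v)).
(* The source term [f] cancels between consecutive iterates, so their difference is the image of the
   previous difference under the contraction [z^-1 A]. *)
rewrite [_ - _](_ : _ = z^-1 * A (fun u => -1 * neumann f n u + neumann f n.+1 u) v).
  rewrite exprS mulrCA; apply: contraction => u.
  by rewrite mulN1r addrC.
by rewrite adjacencyD mulN1r -[neumann f n.+2 v]/(z^-1 * (_ - _)) /=; ring.
Qed.

(** The pointwise limit of the iterates, with default value 0 where they do not converge
    geometrically; for bounded [f] they always do. *)
Definition resolvent f v : R[i] :=
  xget 0 [set l | geometric_cvg (fun n => neumann f n v) l].

Lemma resolvent_rate f M n v : (forall u, normc (f u) <= M) ->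
  normc (neumann f n v - resolvent f v) <= 4 * (M / normc z) * 2^-1 ^+ n.
Proof.
move=> fM.
have [l lP] := complex_geometric_limit (fun n => neumann_step n v fM).
suff -> : resolvent f v = l by [].
rewrite /resolvent; case: xgetP => [l' _ l'P|/(_ l)[]]; last by exists (4 * (M / normc z)).
by apply: geometric_cvg_unique l'P _; exists (4 * (M / normc z)).
Qed.

Lemma resolvent_cvg f M v : (forall u, normc (f u) <= M) ->
  geometric_cvg (fun n => neumann f n v) (resolvent f v).
Proof. by move=> fM; exists (4 * (M / normc z)) => n; exact: resolvent_rate. Qed.

Lemma neumann_linear a f g n v :
  neumann (fun u => a * f u + g u) n v = a * neumann f n v + neumann g n v.
Proof.
elim: n v => [|n IH] v /=; first by rewrite mulr0 addr0.
rewrite (_ : neumann _ n = fun u => a * neumann f n u + neumann g n u).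
  by rewrite adjacencyD; ring.
exact/funext.
Qed.

Lemma resolvent_linear a f g M K :
  (forall u, normc (f u) <= M) -> (forall u, normc (g u) <= K) ->
  resolvent ((a \*o f) \+ g) = (a \*o resolvent f) \+ resolvent g.
Proof.
move=> fM gK; apply/funext => v.
apply: (@geometric_cvg_unique _ (fun n => neumann ((a \*o f) \+ g) n v)).
  apply: (@resolvent_cvg _ (normc a * M + K)) => u /=.
  by rewrite (le_trans (normcD _ _))// lerD// Normc.normcM ler_wpM2l ?normc_ge0.
rewrite (_ : (fun _ => _) = fun n => a * neumann f n v + neumann g n v).
  by apply: geometric_cvgD; [apply: geometric_cvgM|]; apply: resolvent_cvg; eassumption.
by apply/funext => n; rewrite -neumann_linear.
Qed.

(** Pass to the limit in the recursion defining [neumann]: the shifted sequence has the same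
    limit. *)
Lemma adjacency_resolvent f M : (forall u, normc (f u) <= M) ->
  A (resolvent f) \- (z \*o resolvent f) = f.
Proof.
move=> fM; apply/funext => v /=.
suff -> : resolvent f v = z^-1 * (A (resolvent f) v - f v) by field.
apply: (geometric_cvg_unique (geometric_cvgS (resolvent_cvg v fM))) => /=.
apply: geometric_cvgM; apply: geometric_cvgD; last exact: geometric_cvg_cst.
by apply: geometric_cvg_adjacency => w; exact: resolvent_cvg fM.
Qed.

(** For the source [(A - z) f] the error of the iterates with respect to [f] starts at [- f] and is
    multiplied by [z^-1 A] at each step, hence tends to 0. *)
Lemma resolvent_adjacency f M : (forall u, normc (f u) <= M) ->
  resolvent (A f \- (z \*o f)) = f.
Proof.
move=> fM; apply/funext => v.
have gM u : normc ((A f \- (z \*o f)) u) <= d%:R * M + normc z * M.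
  rewrite (le_trans (normcB _ _))// lerD ?adjacency_sup//=.
  by rewrite Normc.normcM ler_wpM2l ?normc_ge0.
apply: (geometric_cvg_unique (resolvent_cvg v gM)); exists M => n.
elim: n v => [|n IH] v /=; first by rewrite sub0r (normcN (f v)) expr0 mulr1.
rewrite [_ - f v](_ : _ = z^-1 * A (fun u => -1 * f u +
    neumann (A f \- (z \*o f)) n u) v); last by rewrite adjacencyD; field.
rewrite exprS mulrCA; apply: contraction => u.
by rewrite mulN1r addrC.
Qed.

(** The bound reproduces itself: [2 d <= normc z] gives [A (neumann f n)] the bound [M], and the
    squared triangle inequality then yields [2 * (M + M) / normc z ^+ 2]. *)
Lemma neumann_l2bound f M n : l2bound f M ->
  l2bound (neumann f n) (4 * M / normc z ^+ 2).
Proof.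
move=> fM; have M0 := l2bound_ge0 fM.
elim: n => [|n /adjacency_l2bound IH] X.
  rewrite big1 => [|v _]; last by rewrite Normc.normc0 expr0n.
  by rewrite divr_ge0 ?sqr_ge0// mulr_ge0.
have step v : normc (neumann f n.+1 v) ^+ 2 <=
    2 / normc z ^+ 2 * (normc (A (neumann f n) v) ^+ 2 + normc (f v) ^+ 2).
  rewrite /= Normc.normcM Normc.normcV exprMn exprVn [leLHS]mulrC [leRHS]mulrAC.
  rewrite ler_wpM2r ?invr_ge0 ?sqr_ge0//.
  have := normcB (A (neumann f n) v) (f v); have := normc_ge0 (A (neumann f n) v - f v).
  move: (normc (A (neumann f n) v - f v)) (normc (A (neumann f n) v))
    (normc (f v)) => a b c a0 abc.
  have : a ^+ 2 <= (b + c) ^+ 2 by rewrite ler_pXn2r ?nnegrE// (le_trans a0 abc).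
  by have := sqr_ge0 (b - c); nra.
rewrite (le_trans (ler_sum _ (fun v _ => step v)))// -mulr_sumr big_split/=.
have z2 : 0 < normc z ^+ 2 by rewrite exprn_gt0.
rewrite mulrAC ler_pM2r ?invr_gt0//.
have dz : d%:R ^+ 2 * (4 * M / normc z ^+ 2) <= M.
  rewrite mulrA ler_pdivrMr//.
  have : (2 * d%:R) ^+ 2 <= normc z ^+ 2 by rewrite ler_pXn2r ?nnegrE ?normc_ge0 ?mulr_ge0.
  by nra.
by have := IH X; have := fM X; lra.
Qed.

(** On a finite set [X] compare the limit with the [n]-th iterate: squaring the triangle inequality
    doubles the constant 4, and the remaining error is at most [2 |X| c^2 2^-n], which vanishes as
    [n] grows. *)
Lemma resolvent_l2bound f M : l2bound f M ->
  l2bound (resolvent f) (8 * M / normc z ^+ 2).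
Proof.
move=> fM X; have fK v := l2bound_sup v fM; set K := Num.sqrt M in fK.
pose c := 4 * (K / normc z).
apply: (@le_of_geometric _ _ _ (2 * (size X)%:R * c ^+ 2)) => n.
have p0 : 0 <= 2^-1 ^+ n :> R by rewrite exprn_ge0// invr_ge0.
have step v : normc (resolvent f v) ^+ 2 <=
    2 * normc (neumann f n v) ^+ 2 + 2 * c ^+ 2 * 2^-1 ^+ n.
  have := resolvent_rate n v fK; rewrite -/c.
  have := normcB (neumann f n v) (neumann f n v - resolvent f v); rewrite subKr.
  have := normc_ge0 (neumann f n v - resolvent f v); have := normc_ge0 (resolvent f v).
  have p1 : 2^-1 ^+ n <= 1 :> R by rewrite exprn_ile1 ?invr_ge0 ?invf_le1 ?ler1n.
  move: (normc (resolvent f v)) (normc (neumann f n v - resolvent f v))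
    (normc (neumann f n v)) => x y t x0 y0 xty ycp.
  have : y ^+ 2 <= (c * 2^-1 ^+ n) ^+ 2.
    by rewrite ler_pXn2r ?nnegrE// (le_trans y0 ycp).
  have : x ^+ 2 <= (t + y) ^+ 2 by rewrite ler_pXn2r ?nnegrE// (le_trans x0 xty).
  rewrite exprMn => h1 h2.
  have h3 : c ^+ 2 * (2^-1 ^+ n) ^+ 2 <= c ^+ 2 * 2^-1 ^+ n.
    by rewrite ler_wpM2l ?sqr_ge0// expr2 ler_piMr.
  by have := sqr_ge0 (t - y); nra.
rewrite (le_trans (ler_sum _ (fun v _ => step v)))// big_split/= -mulr_sumr.
rewrite sumr_const_seq -[_ *+ size X]mulr_natl.
have := neumann_l2bound n fM X; lra.
Qed.

Lemma large_resolvent_set : resolvent_set A z.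
Proof.
exists resolvent; split; first split.
- by move=> f /l2_l2bound /resolvent_l2bound /l2bound_l2.
- move=> a f g /l2_l2bound fM /l2_l2bound gM.
  exact: resolvent_linear (fun v => l2bound_sup v fM) (fun v => l2bound_sup v gM).
- exists (Num.sqrt (8 / normc z ^+ 2)) => f /l2_l2bound fM.
  rewrite /l2norm -sqrtrM ?divr_ge0 ?sqr_ge0// ler_wsqrtr//.
  by rewrite mulrAC; exact: l2bound_fine (resolvent_l2bound fM).
move=> f /l2_l2bound fM; split.
  exact: resolvent_adjacency (fun v => l2bound_sup v fM).
exact: adjacency_resolvent (fun v => l2bound_sup v fM).
Qed.

End BoundedDegree.

(** * R-limits of adjacency operators *)

Lemma card_le_injective {T U : Type} (A : set T) (B : set U) (f : T -> U) :
  {in A &, injective f} -> (forall x, A x -> B (f x)) -> (A #<= B)%card.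
Proof.
move=> finj fAB; rewrite -(card_le_eql (inj_card_eq finj)).
by apply: subset_card_le => _ [x Ax <-]; exact: fAB.
Qed.

Section LocallyFinite.
Context {R : realType} {V : choiceType} (G : graph V).
Implicit Types (u v w : V) (f : V -> R[i]).

Lemma adjacency_dirac v w : finite_set (neighbors G v) ->
  adjacency_op G (dirac_fun R w) v = (G v w)%:R.
Proof.
move=> finv; rewrite /adjacency_op fsbig_finite//= /dirac_fun.
have [vw|vw] := boolP (G v w).
  rewrite (big_fsetD1 w)/=; last by rewrite in_fset_set// inE.
  rewrite eqxx big1_seq ?addr0// => u /andP[_]; rewrite !inE => /andP[/negbTE ->//].
rewrite big1_seq// => u /andP[_]; rewrite in_fset_set// inE => vu.
by case: eqP => // uw; rewrite -uw vu in vw.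
Qed.

Lemma adjacency_dirac_diag v : adjacency_op G (dirac_fun R v) v = 0.
Proof.
rewrite /adjacency_op fsbig1// => u vu; rewrite /dirac_fun.
by case: eqP => // uv; move: vu; rewrite uv /neighbors /= adj_irr.
Qed.

(** The coefficient [schrodinger G Q (dirac_fun R v) v] is the diagonal matrix entry, that is [Q v]
    minus the degree of [v]. A vanishing diagonal therefore characterizes the adjacency operator. *)
Lemma schrodingerE (Q : V -> R) f v : finite_set (neighbors G v) ->
  schrodinger G Q f v =
  adjacency_op G f v + schrodinger G Q (dirac_fun R v) v * f v.
Proof.
move=> finv; rewrite /schrodinger /adjacency_op !fsbig_finite//= !big_split/=.
have -> : \sum_(u <- fset_set (neighbors G v)) dirac_fun R v u = 0.
  by rewrite -(fsbig_finite _ _ finv); exact: adjacency_dirac_diag.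
by rewrite /dirac_fun eqxx !sumr_const_seq !mulr1n add0r mulrDl mulrnAl mulN1r mulr1 addrA.
Qed.

End LocallyFinite.

(** * Indexing the vertices of a ball *)

Section Coherent.
Context {V : choiceType} (G : graph V) (v : V) (eta : nat -> V -> nat) (r : nat).
Hypotheses (r_gt0 : (0 < r)%N) (coh : coherent G v eta).
Local Notation vertex := ('pinv_(fun=> v) (gball G v r) (eta r)).

Lemma coherent_finite_gball : finite_set (gball G v r).
Proof.
have [cohb _] := coh; apply/finite_set_leP; exists (ball_size G v r).
have [efun einj _] := cohb r r_gt0.
exact: card_le_injective einj efun.
Qed.

Lemma vertexK u : gball G v r u -> vertex (eta r u) = u.
Proof.
move=> ru; have [_ einj _] := coh.1 _ r_gt0.
by rewrite pinvKV// inE.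
Qed.

Lemma coherent_lt u : gball G v r u -> (eta r u < ball_size G v r)%N.
Proof. by have [efun _ _] := coh.1 _ r_gt0; exact: efun. Qed.

Lemma vertex_gball i : (i < ball_size G v r)%N -> gball G v r (vertex i).
Proof. by have [efun _ _] := bijpinv_bij (fun=> v) (coh.1 _ r_gt0); exact: efun. Qed.

Lemma vertex_inj : {in `I_(ball_size G v r) &, injective vertex}.
Proof. by have [_ einj _] := bijpinv_bij (fun=> v) (coh.1 _ r_gt0). Qed.

End Coherent.

(** The values 0 and 1 are at distance 1, so a convergent sequence of them is eventually
    constant. *)
Lemma cvg_bool_nat {R : realType} (b : nat -> bool) (c : bool) :
  (fun n => (b n)%:R : cplx R) @ \oo --> (c%:R : cplx R) ->
  \forall n \near \oo, b n = c.
Proof.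
move/cvgrPdist_lt => /(_ 1 ltr01); apply: filterS => n.
by case: (b n) c => [] [] //=; rewrite ?(subr0, sub0r, normrN) normr1 ltxx.
Qed.

(** * Passing the degree bound and the zero diagonal to an R-limit *)

Section RLimit.
Context {R : realType} {V V' : choiceType} (G : graph V) (G' : graph V').
Variables (x : nat -> V) (H' : (V' -> R[i]) -> V' -> R[i]) (v' : V') (d : nat).
Hypothesis locally_finite : forall v, finite_set (neighbors G v).
Hypothesis eventual_degree : forall r, \forall n \near \oo,
  forall u, gball G (x n) r u -> (neighbors G u #<= `I_d)%card.
Hypothesis limH : is_Rlimit_along G (adjacency_op G) x G' H' v'.

(** The diagonal entries along the sequence are 0, hence so is the limit. The other entries are 0 or
    1 and eventually stationary, so for large [j] equality of indices embeds the neighbors of [u]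
    into those of a vertex of [G] near [x (n j)]. *)
Lemma Rlimit_bounded_degree u :
  H' (dirac_fun R u) u = 0 /\ (neighbors G' u #<= `I_d)%card.
Proof.
have [[Q [_ HQ]] [n [eta [eta' [n_homo coh coh' lim]]]]] := limH.
(* One more than the distance to [u], so that the ball contains all neighbors of [u] as well. *)
pose r := (dist G' v' u).+1; have r0 : (0 < r)%N by [].
have [size_eq M_lim] := lim r r0; set N := ball_size G' v' r in size_eq M_lim.
have ru : gball G' v' r u by rewrite /gball /= leqnSn.
have rnbr w : G' u w -> gball G' v' r w.
  move=> uw; rewrite /gball /= (leq_trans (dist_triangle G' v' u w))//.
  by rewrite /r -addn1 leq_add2l dist_adj.
have finu : finite_set (neighbors G' u).
  by apply: sub_finite_set (coherent_finite_gball r0 coh') => w; exact: rnbr.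
pose vtx j := 'pinv_(fun=> x (n j)) (gball G (x (n j)) r) (eta j r).
have entry (i k : 'I_N) : (fun j => adjacency_op G (dirac_fun R (vtx j k)) (vtx j i) : cplx R)
    @ \oo --> ball_matrix G' H' v' eta' r N i k.
  have := cvg_comp _ _ M_lim (@coord_continuous _ _ _ i k _).
  apply: cvg_trans; rewrite /comp; apply: near_eq_cvg; apply: nearW => j.
  by rewrite mxE.
pose i := Ordinal (coherent_lt r0 coh' ru).
have vi : 'pinv_(fun=> v') (gball G' v' r) (eta' r) i = u by exact: vertexK.
have diag : H' (dirac_fun R u) u = 0.
  have lim0 : (fun=> 0 : cplx R) @ \oo --> ball_matrix G' H' v' eta' r N i i.
    rewrite (_ : (fun _ : nat => 0) = fun j => adjacency_op G (dirac_fun R (vtx j i)) (vtx j i)).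
      exact: entry.
    by apply/funext => j; rewrite adjacency_dirac_diag.
  by have := cvg_unique _ lim0 (cvg_cst 0); rewrite mxE vi; apply.
split => //.
have offdiag w : H' (dirac_fun R w) u = (G' u w)%:R.
  rewrite HQ schrodingerE// -HQ diag mul0r addr0 adjacency_dirac//.
(* Only finitely many indices [k] occur, so the row of [u] stabilizes from a common rank on. *)
have /filter_forall near_eq (k : 'I_N) : \forall j \near \oo,
    G (vtx j i) (vtx j k) = G' u ('pinv_(fun=> v') (gball G' v' r) (eta' r) k).
  apply: (@cvg_bool_nat R); move: (entry i k); rewrite mxE vi offdiag.
  by apply: cvg_trans; apply: near_eq_cvg; apply: nearW => j; rewrite adjacency_dirac.
have n_ge j : (j <= n j)%N by elim: j => // j /leq_ltn_trans; apply; exact: n_homo.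
have n_cvg : n @ \oo --> \oo.
  by apply/cvgnyPge => m; exists m => //= j /leq_trans; apply.
have near_deg := n_cvg _ (eventual_degree r).
have [j [[sj ej] dj]] : exists j, (ball_size G (x (n j)) r = N /\
     forall k : 'I_N, G (vtx j i) (vtx j k) = G' u ('pinv_(fun=> v') (gball G' v' r) (eta' r) k)) /\
   forall w, gball G (x (n j)) r w -> (neighbors G w #<= `I_d)%card.
  by have [j jP] := filter_ex (filterI (filterI size_eq near_eq) near_deg); exists j.
apply: card_le_trans (dj (vtx j i) _); last first.
  by apply: (vertex_gball r0 (coh j)); rewrite sj.
have lt_size w : G' u w -> (eta' r w < ball_size G (x (n j)) r)%N.
  by move=> /rnbr uw; rewrite sj; exact: coherent_lt.
(* Send a neighbor of [u] to the vertex of [G] carrying the same index. *)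
apply: (@card_le_injective _ _ _ _ (vtx j \o eta' r)).
  move=> w w'; rewrite !inE => uw uw' /= eqw.
  have [_ einj _] := coh'.1 r r0.
  apply: einj; rewrite ?inE; [exact: rnbr..|].
  by apply: (vertex_inj r0 (coh j)) eqw; rewrite inE; exact: lt_size.
move=> w uw; change (G (vtx j i) (vtx j (eta' r w))).
have := ej (Ordinal (coherent_lt r0 coh' (rnbr w uw))).
by rewrite /= (vertexK r0 coh' (rnbr w uw)) => ->.
Qed.

Lemma Rlimit_adjacency : H' = adjacency_op G'.
Proof.
have [[Q [_ HQ]] _] := limH.
apply/funext => f; apply/funext => u; have [H0 du] := Rlimit_bounded_degree u.
rewrite HQ schrodingerE -?HQ ?H0 ?mul0r ?addr0//.
by apply/finite_set_leP; exists d.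
Qed.

End RLimit.

(** * The comb *)

(* [inl (a, b)] is the vertex of height [b] on the tooth of index [a + b], [a]
   steps below the tip [inl (0, a + b)]; the teeth are finite and [inl (k, 0)]
   lies on the spine.  The [inr (k, s, i)], for [s : bool] and [i : 'I_8], are
   the vertices of the two copies of K_8 attached to the tip of tooth [k]. *)
Definition vertex : choiceType := (nat * nat + nat * bool * 'I_8)%type.
Implicit Types u v w : vertex.

Definition spine k : vertex := inl (k, 0%N).

(** The parent relation is a spanning tree rooted at [spine 0]. The root is its own parent because
    the predecessor of 0 is 0; [comb_adj] discards this loop. *)
Definition parent v : vertex :=
  match v with
  | inl (a, b.+1) => inl (a.+1, b)
  | inl (a, 0) => spine a.-1
  | inr (k, _, _) => inl (0%N, k)
  end.

Definition same_clique u v : bool :=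
  match u, v with
  | inr (k, s, _), inr (l, t, _) => (k == l) && (s == t)
  | _, _ => false
  end.

Definition comb_adj u v : bool :=
  (u != v) && [|| parent u == v, parent v == u | same_clique u v].

Definition column v : nat :=
  match v with inl (a, b) => a + b | inr (k, _, _) => k end.

Definition height v : nat :=
  match v with inl (_, b) => b | inr (k, _, _) => k.+1 end.

Lemma comb_adj_sym : symmetric comb_adj.
Proof.
move=> u v; rewrite /comb_adj eq_sym; congr (_ && _).
rewrite orbCA; congr [|| _, _ | _].
by case: u v => [[a b]|[[k s] i]] [[a' b']|[[k' s'] i']]//=; rewrite eq_sym (eq_sym s).
Qed.

Lemma comb_adj_irr : irreflexive comb_adj.
Proof. by move=> u; rewrite /comb_adj eqxx. Qed.

Lemma path_to_root v :
  exists p, [/\ path comb_adj v p, last v p = spine 0%N & (size p <= 2 * column v + 1)%N].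
Proof.
(* This quantity drops by exactly one from a vertex other than the root to its parent, and it is at
   most [2 * column v + 1] because the height is at most [column v + 1]. *)
pose e v := (column v + height v)%N.
suff : exists p, [/\ path comb_adj v p, last v p = spine 0%N & (size p <= e v)%N].
  case=> p [vp pv sp]; exists p; split=> //; apply: leq_trans sp _.
  by rewrite /e; case: v {vp pv} => [[a b]|[[k s] i]] /=; lia.
move: {2}(e v) (leqnn (e v)) => n; elim: n v => [|n IH] v vn.
  exists [::]; split=> //=; move: vn; rewrite /e.
  case: v => [[a b]|[[k s] i]] /= vn; last by lia.
  by have [-> ->] : a = 0%N /\ b = 0%N by lia.
have [->|v0] := eqVneq v (spine 0%N); first by exists [::].
have pe : (e (parent v)).+1 = e v.
  by move: v0; rewrite /e; case: v {vn} => [[[|a] [|b]]|[[k s] i]] //=;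
    rewrite ?eqxx// => _; lia.
have [p [pp pl ps]] : exists p, [/\ path comb_adj (parent v) p,
    last (parent v) p = spine 0%N & (size p <= e (parent v))%N].
  by apply: IH; rewrite -ltnS pe.
exists (parent v :: p); split=> //=; last by rewrite -pe.
rewrite pp andbT /comb_adj eqxx andbT.
by apply: contraPneq pe => <-; move: (e v) => m; lia.
Qed.

Lemma comb_connected u v : exists p, path comb_adj u p && (last u p == v).
Proof.
have [p [pu pl _]] := path_to_root u; have [q [qv ql _]] := path_to_root v.
exists (p ++ rev (belast v q)); rewrite cat_path pu last_cat pl/=.
have := rev_path comb_adj v q; rewrite ql (eq_path (e' := comb_adj)) => [->|x y].
  rewrite qv/=; case: q {qv} ql => [<-//|x q _]; by rewrite /= rev_cons last_rcons.
exact: comb_adj_sym.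
Qed.

Definition comb := Graph comb_adj_sym comb_adj_irr comb_connected.

Lemma comb_adjP u v : comb u v ->
  [\/ v = parent u, u = parent v | same_clique u v].
Proof.
by case/andP=> _ /or3P[/eqP<-|/eqP<-|uv]; [exact: Or31|exact: Or32|exact: Or33].
Qed.

Lemma column_lipschitz u v : comb u v -> (column v <= column u + 1)%N.
Proof.
case/comb_adjP => [->|->|].
- by case: u => [[[|a] [|b]]|[[k s] i]] //=; lia.
- by case: v => [[[|a] [|b]]|[[k s] i]] //=; lia.
case: u v => [[a b]|[[k s] i]] [[a' b']|[[k' s'] i']]//= /andP[/eqP -> _]; lia.
Qed.

Lemma height_lipschitz u v : comb u v -> (height v <= height u + 1)%N.
Proof.
case/comb_adjP => [->|->|].
- by case: u => [[[|a] [|b]]|[[k s] i]] //=; lia.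
- by case: v => [[[|a] [|b]]|[[k s] i]] //=; lia.
case: u v => [[a b]|[[k s] i]] [[a' b']|[[k' s'] i']]//= /andP[/eqP -> _]; lia.
Qed.

(** Tooth edges and clique edges stay in one column; only spine edges change it. *)
Lemma column_change u v : comb u v -> column u != column v -> u = spine (column u).
Proof.
case/comb_adjP => [->|->|].
- by case: u => [[[|a] [|b]]|[[k s] i]] //=; rewrite ?addn0 ?addSnnS ?eqxx.
- by case: v => [[[|a] [|b]]|[[k s] i]] //=; rewrite ?addn0 ?addSnnS ?eqxx.
by case: u v => [[a b]|[[k s] i]] [[a' b']|[[k' s'] i']]//= /andP[/eqP -> _]; rewrite eqxx.
Qed.

Lemma column_le_dist k v : (column v <= k + dist comb (spine k) v)%N.
Proof.
by have := lipschitz_dist (spine k) v column_lipschitz; rewrite /= addn0.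
Qed.

Lemma dist_root_le v : (dist comb v (spine 0%N) <= 2 * column v + 1)%N.
Proof.
have [p [vp pl ps]] := path_to_root v.
by rewrite -pl (leq_trans _ ps)// dist_path.
Qed.

(** A geodesic to another column has to pass through the base of the tooth of [u], and reaches it
    after at least one step. *)
Lemma dist_spine_lt u v : column u != column v -> u != spine (column u) ->
  (dist comb (spine (column u)) v < dist comb u v)%N.
Proof.
have [p [pu <- <-]] := geodesic comb u v.
elim: p u pu => [|w p IH] u /=; first by rewrite eqxx.
case/andP=> uw pw cu us.
have cw : column w = column u.
  by apply/eqP; apply: contraNT us; rewrite eq_sym => /(column_change uw) /eqP.
have [ws|ws] := eqVneq w (spine (column w)).
  by rewrite -cw -ws ltnS dist_path.
by rewrite -cw ltnS ltnW// IH// cw.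
Qed.

(** * Paths to infinity in the comb *)

Section PathToInfinity.
Variable x : nat -> vertex.
Hypothesis x_path : path_to_infinity comb x.

Lemma column_cvg : column (x n) @[n --> \oo] --> \oo.
Proof.
have [_ _ /cvgnyPge xoo] := x_path.
apply/cvgnyPge => c.
(* The detour through the root has length at most [2 * column (x n) + 1] plus the last term, so a
   distance this large forces the column above [c]. *)
apply: filterS (xoo (2 * c + 2 + dist comb (spine 0%N) (x 0%N))%N) => n.
have := dist_triangle comb (x n) (spine 0%N) (x 0%N).
have := dist_root_le (x n); lia.
Qed.

(* Otherwise the path has to leave the tooth through its base, which is closer
   to the starting point, against the monotonicity of the distance. *)
Lemma eventually_spine : \forall n \near \oo, x n = spine (column (x n)).
Proof.
have [adjx dmono xoo] := x_path.
have /cvgnyPgt coo := column_cvg.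
have [N _ Ncol] := coo (column (x 0%N)).
exists N => // n Nn; apply/eqP; apply/negPn/negP => nspine.
have colneq m : (N <= m)%N -> column (x m) != column (x 0%N).
  by move=> /Ncol; rewrite neq_ltn orbC => ->.
(* The first such index is a successor [m.+1], and [x m] is then the base of the tooth containing
   [x n]. *)
have exit : exists m, (n <= m)%N && (column (x m) != column (x n)).
  have [M _ Mcol] := coo (column (x n)).
  exists (maxn n M); rewrite leq_maxl neq_ltn orbC.
  by rewrite (Mcol (maxn n M) (leq_maxr _ _)).
case: (ex_minnP exit) => -[|m] /andP[nm cm] mmin.
  by move: nm cm; rewrite leqn0 => /eqP ->; rewrite eqxx.
have {}nm : (n <= m)%N.
  by move: nm; rewrite leq_eqVlt => /orP[/eqP nm|//]; rewrite nm eqxx in cm.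
have cmn : column (x m) = column (x n).
  apply/eqP/negPn/negP => cmn; have := mmin m; rewrite nm cmn => /(_ isT).
  by rewrite ltnn.
have xm : x m = spine (column (x n)).
  rewrite -cmn; apply: (@column_change _ (x m.+1)); last by rewrite cmn eq_sym.
  by rewrite adj_sym; exact: adjx.
have := dist_spine_lt (colneq n Nn) nspine; rewrite -xm ltnNge.
by rewrite (dmono _ _ nm).
Qed.

End PathToInfinity.

Lemma card_le_seq (T : choiceType) (A : set T) (s : seq T) :
  (forall x, A x -> x \in s) -> (A #<= `I_(size s))%card.
Proof.
move=> As; apply: (@card_le_injective _ _ _ _ (index^~ s)).
  by move=> x y; rewrite !inE => /As xs /As ys /(congr1 (nth x s)); rewrite !nth_index.
by move=> x /As; rewrite /= index_mem.
Qed.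

(** The hypothesis excludes tips and clique vertices. What remains is the parent, the next vertex up
    the tooth and, on the spine, the next spine vertex. *)
Lemma comb_degree_le3 v : (height v < column v)%N -> (neighbors comb v #<= `I_3)%card.
Proof.
case: v => [[[|a] b]|[[k s] i]] /=; try lia.
move=> _; apply: (@card_le_seq _ _ [:: parent (inl (a.+1, b)); inl (a, b.+1); spine a.+2]) => v.
rewrite !inE => /comb_adjP[->|ab|]; first by rewrite eqxx.
  move: ab; case: v => [[[|a'] [|b']]|[[k s] i]] //= [-> ->]; by rewrite eqxx ?orbT.
by case: v.
Qed.

Definition clique k : seq vertex :=
  [seq inr (k, p.1, p.2) | p <- enum ((bool * 'I_8)%type : finType)].

Lemma mem_clique k l s i : (inr (k, s, i) \in clique l) = (k == l).
Proof.
apply/mapP/eqP => [[p _ [-> _ _]]//|->].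
by exists (s, i); rewrite ?mem_enum.
Qed.

Lemma comb_bounded_degree : bounded_degree comb.
Proof.
exists (3 + 16)%N => v.
pose top u := if u is inl (a, _) then a else 0%N.
(* A crude list valid for every kind of vertex: the parent, the next vertices up the tooth and along
   the spine, and the 16 vertices of both cliques of the column. *)
have -> : (3 + 16)%N =
    size [:: parent v, inl ((top v).-1, (height v).+1), spine (top v).+1
           & clique (column v)].
  by rewrite /= size_map -cardE card_prod card_bool card_ord.
apply: card_le_seq => w; rewrite !inE => /comb_adjP[->|->|]; first by rewrite eqxx.
  case: w => [[[|c] [|b]]|[[k s] i]] //=; rewrite ?eqxx ?orbT//.
  by rewrite mem_clique eqxx !orbT.
case: v w => [[c b]|[[k s] i]] [[c' b']|[[k' s'] i']]//= /andP[/eqP <- _].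
by rewrite mem_clique eqxx ?orbT.
Qed.

(** * Growth and eigenfunctions of the comb *)

(** Around a spine vertex of column above [2 * r], the ball of radius [r] has heights at most [r]
    and columns above [r], so it meets neither tips nor cliques. *)
Lemma comb_eventual_degree (x : nat -> vertex) r : path_to_infinity comb x ->
  \forall n \near \oo,
    forall u, gball comb (x n) r u -> (neighbors comb u #<= `I_3)%card.
Proof.
move=> x_path; have /cvgnyPgt/(_ (2 * r)%N) := column_cvg x_path.
apply: filterS2 (eventually_spine x_path) => n xn rn u; rewrite /gball /= => xu.
apply: comb_degree_le3.
have := lipschitz_dist (x n) u height_lipschitz; rewrite {1}xn /= => hu.
have := lipschitz_dist_sym (x n) u column_lipschitz; lia.
Qed.

Lemma comb_infinite : infinite_set [set: vertex].
Proof.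
apply/infiniteP; apply: (@card_le_injective _ _ _ _ spine) => // k l _ _.
by case.
Qed.

Lemma dist_spine k : (dist comb (spine 0%N) (spine k) <= k)%N.
Proof.
elim: k => [|k IH]; first by rewrite distxx.
rewrite (leq_trans (dist_triangle comb _ (spine k) _))// -[leqRHS]addn1 leq_add//.
apply: dist_adj; apply/andP; split; first by apply/eqP => -[]; lia.
exact/or3P/Or32.
Qed.

Lemma comb_ball_size r : (0 < r)%N ->
  (r <= ball_size comb (spine 0%N) r <= 36 * r ^ 2)%N.
Proof.
move=> r0.
(* All vertices of column at most [r] are in this list. Its length [(r + 1)^2 + 16 (r + 1)] is at
   most [4 r^2 + 32 r^2] for [r >= 1]; the lower bound counts the first [r] spine vertices. *)
pose s : seq vertex := [seq inl (a, b) | a <- iota 0 r.+1, b <- iota 0 r.+1] ++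
  flatten [seq clique k | k <- iota 0 r.+1].
have sz : size s = (r.+1 ^ 2 + 16 * r.+1)%N.
  rewrite size_cat size_allpairs !size_iota mulnn size_flatten /shape -map_comp.
  rewrite (eq_map (g := fun=> 16%N)) => [|k /=]; last first.
    by rewrite size_map -cardE card_prod card_bool card_ord.
  by rewrite sumnE big_map big_const_seq count_predT size_iota iter_addn_0.
have sub v : gball comb (spine 0%N) r v -> v \in s.
  rewrite /gball /= => vr; have := leq_trans (column_le_dist 0%N v) vr.
  rewrite mem_cat; case: v {vr} => [[a b]|[[k t] i]] vr; simpl in vr; apply/orP; [left|right].
    by apply: (@allpairs_f _ _ vertex (fun a b => inl (a, b))); rewrite mem_iota; lia.
  apply/flattenP; exists (clique k); last by rewrite mem_clique.
  by apply: map_f; rewrite mem_iota; lia.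
have ball_le := card_le_seq sub.
have ball_fin : finite_set (gball comb (spine 0%N) r).
  by apply/finite_set_leP; eexists; exact: ball_le.
apply/andP; split; last first.
  by apply: leq_trans (geq_card_fset_set ball_le) _; rewrite sz; nia.
rewrite -[leqLHS](size_iota 0) -(size_map spine).
apply: uniq_leq_size; first by rewrite map_inj_uniq ?iota_uniq// => k l [].
move=> v /mapP[k kr ->]; move: kr; rewrite mem_iota => kr; rewrite in_fset_set// inE /gball /=.
by rewrite (leq_trans (dist_spine k))//; lia.
Qed.

Lemma comb_polynomial_growth (R : realType) : polynomial_growth comb R.
Proof.
exists 1, 2, (spine 0%N), 1, 36; split=> // r r0.
have /andP[lo hi] := comb_ball_size r0.
rewrite powRr1// mul1r ler_nat lo/=.
by rewrite (powR_mulrn 2)// -natrX -natrM ler_nat.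
Qed.

Lemma comb_tip a b k s i : comb (inl (a, b)) (inr (k, s, i)) = ((a, b) == (0%N, k)).
Proof.
rewrite /= /comb_adj /= orbF -/(spine a.-1).
have -> : (parent (inl (a, b)) == inr (k, s, i)) = false by case: a b => [|a] [|b].
exact: eq_sym.
Qed.

Lemma comb_clique l t j k s i :
  comb (inr (l, t, j)) (inr (k, s, i)) = [&& l == k, t == s & j != i].
Proof.
rewrite /= /comb_adj /=; case: (l =P k) => [->|]; last by rewrite andbF.
case: (t =P s) => [->|_] /=; last by rewrite andbF.
by rewrite andbT; congr (~~ _); apply/eqP/eqP => [[->]|->].
Qed.

(** * The eigenvalue 7 and its multiplicity *)

Section Eigenfunction.
Context {R : realType}.
Local Notation A := (adjacency_op (R := R) comb).

Definition clique_fun k (v : vertex) : R[i] :=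
  if v is inr (l, s, _) then (l == k)%:R * (-1) ^+ (s : bool) else 0.

Lemma clique_fun_l2 k : l2 (clique_fun k).
Proof.
apply: (@finite_support_l2 _ _ _ (clique k)) => [[[a b]|[[l s] i]]] //=.
by rewrite mem_clique => /negbTE ->; rewrite mul0r.
Qed.

Lemma comb_finite_neighbors v : finite_set (neighbors comb v).
Proof. by apply/finite_set_leP; have [d dP] := comb_bounded_degree; exists d. Qed.

(** As [clique_fun k] vanishes off the two cliques of tooth [k], the sum over neighbors becomes a
    sum over these 16 vertices with the adjacency indicator as weight. *)
Lemma adjacency_clique_fun_sum k v : A (clique_fun k) v =
  \sum_s \sum_i (comb v (inr (k, s, i)))%:R * (-1) ^+ (s : bool).
Proof.
rewrite pair_big /adjacency_op fsbig_finite/=; last exact: comb_finite_neighbors.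
rewrite [RHS](_ : _ = \sum_(u <- clique k) (comb v u)%:R * clique_fun k u); last first.
  by rewrite big_map big_enum; apply: eq_bigr => -[s i] _ /=; rewrite eqxx mul1r.
rewrite (bigID (fun u => u \in clique k))/= [X in _ + X]big1 ?addr0; last first.
  by move=> [[a b]|[[l s] i]] //=; rewrite mem_clique => /negbTE ->; rewrite mul0r.
rewrite -big_filter [RHS](bigID (fun u => comb v u))/= [X in _ + X]big1 ?addr0; last first.
  by move=> u /negbTE ->; rewrite mul0r.
under [RHS]eq_bigr => u vu do rewrite vu mul1r.
rewrite -[RHS]big_filter; apply: perm_big; apply: uniq_perm.
- by rewrite filter_uniq// fset_uniq.
- rewrite filter_uniq// map_inj_uniq ?enum_uniq// => -[s i] [t j] /= [-> ->//].
move=> u; rewrite !mem_filter andbC in_fset_set; last exact: comb_finite_neighbors.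
by congr (_ && _); apply/idP/idP; rewrite inE.
Qed.

Lemma adjacency_clique_fun k : A (clique_fun k) = 7%:R \*o clique_fun k.
Proof.
apply/funext => v; rewrite adjacency_clique_fun_sum.
case: v => [[a b]|[[l t] j]].
  (* At a tip the contributions of the two cliques cancel; at any other vertex of a tooth there are
     none. *)
  under eq_bigr do under eq_bigr do rewrite comb_tip.
  by rewrite big_bool /= !sumr_const expr1 expr0 mulrN1 mulr1 mulNrn addNr mulr0.
under eq_bigr do under eq_bigr do rewrite comb_clique.
(* The other vertices of the same copy of K_8, all carrying the same sign. *)
have seven : \sum_i (j != i)%:R = 7%:R :> R[i].
  rewrite -natr_sum; congr _%:R.
  rewrite (eq_bigr (fun i => if i \in predC1 j then 1 else 0)%N) => [|i _].
    by rewrite -big_mkcond sum1_card cardC1 card_ord.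
  by rewrite !inE eq_sym; case: eqP.
rewrite /=; case: (l == k); last first.
  by rewrite mul0r mulr0 big1// => s _; rewrite big1// => i _; rewrite /= mulr0n mul0r.
have zero (c : R[i]) : \sum_(i < 8) false%:R * c = 0.
  by rewrite big1// => i _; rewrite mulr0n mul0r.
by rewrite mul1r -seven mulr_suml big_bool; case: t => /=; rewrite zero ?addr0 ?add0r.
Qed.

(** An inverse of [A - 7] would send 0 both to the eigenfunction and to 0. *)
Lemma eigenvalue7_spectrum : spectrum A 7%:R.
Proof.
move=> [B [_ BP]].
have zero_l2 : l2 (fun _ : vertex => 0 : R[i]) by apply: (@finite_support_l2 _ _ _ [::]).
have A0 : A (fun=> 0) = fun=> 0 by apply/funext => v; rewrite /adjacency_op fsbig1.
have [fB _] := BP _ (clique_fun_l2 0); have [zB _] := BP _ zero_l2.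
suff /(congr1 (fun f => f (inr (0%N, false, ord0)))) : clique_fun 0 = fun=> 0.
  by move/eqP; rewrite /= expr0 mulr1 oner_eq0.
rewrite -fB -[RHS]zB; congr B; rewrite A0 adjacency_clique_fun.
by apply/funext => v /=; rewrite subrr mulr0 subr0.
Qed.

(** Evaluating [n + 1] clique functions at one vertex of each of their cliques gives the identity
    matrix, which would factor through dimension [n]. *)
Lemma eigenvalue7_infinite_multiplicity : ~ finite_multiplicity A 7%:R.
Proof.
move=> [n [e eP]].
have {}eP k : exists a : 'I_n -> R[i], clique_fun k = fun v => \sum_(j < n) a j * e j v.
  by apply: eP; split; [exact: clique_fun_l2|exact: adjacency_clique_fun].
have [a aP] := choice eP.
pose M : 'M[R[i]]_(n.+1, n) := \matrix_(k, j) a k j.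
pose N : 'M[R[i]]_(n, n.+1) := \matrix_(j, l) e j (inr (l : nat, false, ord0)).
have MN : M *m N = 1%:M.
  apply/matrixP => k l; rewrite !mxE.
  have := congr1 (fun f => f (inr (l : nat, false, ord0))) (aP k).
  rewrite /= expr0 mulr1 eq_sym => /esym <-.
  by apply: eq_bigr => j _; rewrite !mxE.
by have := mulmx_max_rank M N; rewrite MN mxrank1 ltnn.
Qed.

End Eigenfunction.

Theorem theorem2p2 (R : realType) :
  exists (V : choiceType) (G : graph V),
    [/\ infinite_set [set: V], bounded_degree G, polynomial_growth G R &
      essential_spectrum (adjacency_op (R := R) G)
        `\` closure (Rlimit_spectra G (adjacency_op (R := R) G)) !=set0].
Proof.
exists vertex, comb; split; [exact: comb_infinite|exact: comb_bounded_degree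
  |exact: comb_polynomial_growth|].
exists 7%:R; split; first split.
- exact: eigenvalue7_spectrum.
- by case=> _ _; exact: eigenvalue7_infinite_multiplicity.
(* If 7 were in the closure, the unit ball around it would contain a spectral value [z] of some
   R-limit; but [normc z > 6], twice the degree bound 3, puts [z] in the resolvent set. *)
move=> /(_ _ (nbhsx_ballx (7%:R : cplx R) 1 ltr01)).
move=> [z [[V' [G' [H' [v' [[x [x_path limH]]]]]]] Hz zball]].
have deg r := comb_eventual_degree r x_path.
have := Rlimit_adjacency comb_finite_neighbors deg limH => HA.
apply: Hz; rewrite HA.
have z6 : 6 < Normc.normc z.
  have : Normc.normc (7%:R - z) < 1 by rewrite -ltcR.
  have := normcD (7%:R - z) z; rewrite subrK normc_nat; lra.
apply: (@large_resolvent_set _ _ _ 3).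
- by move=> u; have [] := Rlimit_bounded_degree comb_finite_neighbors deg limH u.
- by apply: lt_trans z6.
- by apply: ltW; rewrite -natrM.
Qed.
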